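(* Let $\{X_n\}_{n=1}^{\infty}$ be a sequence of non-Archimedean metric spaces, and let $X=\{x_i:1\le i\le N\}$ be a finite non-Archimedean metric space of cardinality $N$, with metric $\widehat{d}$. Then $X_n\longrightarrow_{\mathrm{GH}_S}X$ if and only if the following holds: for all sufficiently large $n$, $X_n$ can be split into a disjoint union of $N$ non-empty sets $X_{n,1},X_{n,2},\dots,X_{n,N}$ so that, for all $i,j$, $\operatorname{diam}(X_{n,i})\to 0$ as $n\to\infty$, and $\operatorname{dist}(X_{n,i},X_{n,j})=\widehat{d}(x_i,x_j)$ for all sufficiently large $n$.
   Context: A non-Archimedean metric space $(X,\widehat{d}_X)$ is a set with a metric satisfying the strong triangle inequality $\widehat{d}_X(x,z)\le\max\{\widehat{d}_X(x,y),\widehat{d}_X(y,z)\}$. The non-Archimedean Gromov-Hausdorff distance is $\widehat{d}_{GH}(X,Y)=\inf\{\widehat{d}_{H}(f(X),g(Y))\}$, the infimum being over all non-Archimedean metric spaces $(Z,\widehat{d}_Z)$ and all isometric embeddings $f:X\hookrightarrow Z$, $g:Y\hookrightarrow Z$, where $\widehat{d}_H$ is the Hausdorff distance between subsets of $Z$. For non-Archimedean metric spaces, $X_n\longrightarrow_{\mathrm{GH}_S}X$ means $\widehat{d}_{GH}(X_n,X)\to 0$ as $n\to\infty$. For subsets $A,B$ of a metric space $(Z,d)$, $\operatorname{diam}(A)=\sup\{d(x,y):x,y\in A\}$ and $\operatorname{dist}(A,B)=\inf\{d(x,y):x\in A,y\in B\}$. *)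

(* Defs.v *)
From HB Require Import structures.
From mathcomp Require Import all_boot all_order all_algebra.
From mathcomp Require Import all_classical all_reals all_analysis.

Set Implicit Arguments.
Unset Strict Implicit.
Unset Printing Implicit Defensive.

Import Order.TTheory GRing.Theory Num.Theory.

Local Open Scope classical_set_scope.
Local Open Scope ring_scope.

(* Metric spaces are [metricType R], with real-valued distance [mdist]; they
   are allowed to be empty. *)
Definition non_archimedean (R : realType) (X : metricType R) : Prop :=
  forall x y z : X, mdist x z <= Num.max (mdist x y) (mdist y z).

Definition isometric_embedding (R : realType) (X Z : metricType R)
    (f : X -> Z) : Prop :=
  forall x y : X, mdist (f x) (f y) = mdist x y.

Definition diam (R : realType) (Z : metricType R) (A : set Z) : \bar R :=
  ereal_sup [set d | exists x y, [/\ A x, A y & d = (mdist x y)%:E]].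

Definition dist (R : realType) (Z : metricType R) (A B : set Z) : \bar R :=
  ereal_inf [set d | exists x y, [/\ A x, B y & d = (mdist x y)%:E]].

Definition neighborhood (R : realType) (Z : metricType R) (A : set Z) (r : R)
    : set Z :=
  \bigcup_(a in A) ball a r.

(* Infimum of the radii [r] for which each set lies in the open
   [r]-neighborhood of the other; it is [+oo] when there is no such [r]. *)
Definition hausdorff_dist (R : realType) (Z : metricType R) (A B : set Z)
    : \bar R :=
  ereal_inf [set r%:E | r in [set r : R |
    [/\ 0 < r, A `<=` neighborhood B r & B `<=` neighborhood A r]]].

Definition gh_dist (R : realType) (X Y : metricType R) : \bar R :=
  ereal_inf [set d | exists (Z : metricType R) (f : X -> Z) (g : Y -> Z),
    [/\ non_archimedean Z, isometric_embedding f, isometric_embedding g &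
        d = hausdorff_dist (range f) (range g)]].

Definition gh_converges (R : realType) (X_ : nat -> metricType R)
    (X : metricType R) : Prop :=
  gh_dist (X_ n) X @[n --> \oo] --> 0%E.

(* Main.v *)
(* If the Gromov-Hausdorff distance is smaller than the minimal gap of X, the
   r-balls around the points of X in a common ultrametric space cut X_n into
   pieces of diameter at most r, and since all triangles are isosceles, points
   of distinct pieces lie exactly at the distance of their centres.
   Conversely, a partition into small pieces gives a surjection p : X_n -> X
   distorting distances by at most e in the ultrametric sense, and
   d(y, q) := max(e, d(p y, q)) glues X_n and X into one ultrametric space. *)
Require Import Defs.
From HB Require Import structures.
From mathcomp Require Import all_boot all_order all_algebra.
From mathcomp Require Import all_classical all_reals all_analysis.

Set Implicit Arguments.
Unset Strict Implicit.
Unset Printing Implicit Defensive.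

Import Order.TTheory GRing.Theory Num.Theory.

Local Open Scope classical_set_scope.
Local Open Scope ring_scope.

(** Nonnegativity is asked only eventually because the [diam] of an empty set is [-oo], and pieces
    may be empty for small [n]. *)
Lemma cvge0_nneg (R : realType) (u : nat -> \bar R) :
  (\forall n \near \oo, (0 <= u n)%E) ->
  u n @[n --> \oo] --> 0%E <->
  forall e : R, 0 < e -> \forall n \near \oo, (u n <= e%:E)%E.
Proof.
move=> u0; split=> [/fine_cvgP[ufin /cvgrPdist_le u0e] e e0|ue].
  near=> n.
  have un : u n \is a fin_num by near: n.
  rewrite -(fineK un) lee_fin.
  have : `|0 - fine (u n)| <= e by near: n; exact: u0e.
  by rewrite sub0r normrN; apply: le_trans; exact: ler_norm.
apply/fine_cvgP; split.
  near=> n; rewrite ge0_fin_numE; last by near: n.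
  by apply: (@le_lt_trans _ _ 1%:E); [near: n; exact: ue | exact: ltry].
apply/cvgrPdist_le => e e0; near=> n.
have un0 : (0 <= u n)%E by near: n.
have une : (u n <= e%:E)%E by near: n; exact: ue.
rewrite /= sub0r normrN ger0_norm ?fine_ge0//.
by rewrite -lee_fin fineK// ge0_fin_numE// (le_lt_trans une)// ltry.
Unshelve. all: by end_near. Qed.

(** * Isosceles triangles in an ultrametric space *)

Section ultrametric.
Context {R : realType} {Z : metricType R}.
Hypothesis hZ : non_archimedean Z.

Lemma ultra_lt (r : R) (y x z : Z) : mdist x y < r -> mdist y z < r ->
  mdist x z < r.
Proof. by move=> xy yz; rewrite (le_lt_trans (hZ x y z))// gt_max xy. Qed.

Lemma ultra_isosceles_le (u v y z : Z) :
  mdist y u < mdist u v -> mdist z v < mdist u v -> mdist y z <= mdist u v.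
Proof.
move=> yu zv; rewrite (le_trans (hZ y u z))// ge_max (ltW yu)/=.
by rewrite (le_trans (hZ u v z))// ge_max lexx/= metric_sym ltW.
Qed.

Lemma ultra_isosceles (u v y z : Z) :
  mdist y u < mdist u v -> mdist z v < mdist u v -> mdist y z = mdist u v.
Proof.
move=> yu zv; apply/eqP; rewrite eq_le ultra_isosceles_le//=.
rewrite leNgt; apply/negP => yz.
(* Otherwise every step of the chain [u], [y], [z], [v] would be shorter than [mdist u v]. *)
have : mdist u v < mdist u v; last by rewrite ltxx.
apply: (@ultra_lt _ y); first by rewrite metric_sym.
exact: ultra_lt yz zv.
Qed.

End ultrametric.

(** * Diameters of subsets and distances between them *)

Section diam_dist.
Context {R : realType} {Z : metricType R}.
Implicit Types A B : set Z.

Lemma diam_ge0 A : A !=set0 -> (0 <= diam A)%E.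
Proof.
move=> [a Aa]; apply: ereal_sup_ubound.
by exists a, a; rewrite mdistxx.
Qed.

Lemma mdist_le_diam A (e : R) a b : (diam A <= e%:E)%E -> A a -> A b ->
  mdist a b <= e.
Proof.
move=> Ae Aa Ab; rewrite -lee_fin (le_trans _ Ae)//.
by apply: ereal_sup_ubound; exists a, b.
Qed.

Lemma dist_le_mdist A B (d : R) a b : dist A B = d%:E -> A a -> B b ->
  d <= mdist a b.
Proof.
move=> ABd Aa Bb; rewrite -lee_fin -ABd.
by apply: ereal_inf_lbound; exists a, b.
Qed.

Lemma dist_const A B (d : R) : A !=set0 -> B !=set0 ->
  (forall a b, A a -> B b -> mdist a b = d) -> dist A B = d%:E.
Proof.
move=> [a Aa] [b Bb] ABd; rewrite /dist (_ : [set _ | _] = [set d%:E]).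
  by rewrite ereal_inf1.
apply/seteqP; split=> [_ [u [v [Au Bv ->]]]|_ ->] /=; first by rewrite ABd.
by exists a, b; rewrite ABd.
Qed.

Lemma dist_self A : A !=set0 -> dist A A = 0%E.
Proof.
move=> [a Aa]; apply/eqP; rewrite eq_le; apply/andP; split.
  by apply: ereal_inf_lbound; exists a, a; rewrite mdistxx.
by apply: le_ereal_inf_tmp => _ [u [v [_ _ ->]]]; rewrite lee_fin mdist_ge0.
Qed.

(* An ultrametric is constant on the product of two sets of diameter smaller
   than their distance, so the infimum defining [dist] is attained. *)
Lemma mdist_eq_dist A B (e d : R) a b : non_archimedean Z ->
  (diam A <= e%:E)%E -> (diam B <= e%:E)%E -> dist A B = d%:E -> e < d ->
  A a -> B b -> mdist a b = d.
Proof.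
move=> hZ Ae Be ABd ed Aa Bb; apply/eqP; rewrite eq_le andbC.
rewrite (dist_le_mdist ABd)//= -lee_fin -ABd.
(* Each competitor [mdist u v] bounds [mdist a b], since [a] is closer to [u] and [b] closer to [v]
   than [u] is to [v]. *)
apply: le_ereal_inf_tmp => _ [u [v [Au Bv ->]]]; rewrite lee_fin.
have euv : e < mdist u v := lt_le_trans ed (dist_le_mdist ABd Au Bv).
by apply: ultra_isosceles_le => //; apply: le_lt_trans euv;
  [exact: mdist_le_diam Ae _ _|exact: mdist_le_diam Be _ _].
Qed.

End diam_dist.

(** * From a small Gromov-Hausdorff distance to a partition *)

Lemma gh_dist_ge0 (R : realType) (Y X : metricType R) : (0 <= gh_dist Y X)%E.
Proof.
apply: le_ereal_inf_tmp => _ [Z [f [g [_ _ _ ->]]]].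
by apply: le_ereal_inf_tmp => _ [r [r0 _ _] <-]; rewrite lee_fin ltW.
Qed.

(** Any [r] above the distance and at most the gap works, so [r] can later shrink with the distance
    to force small diameters. *)
Lemma partition_of_gh_dist (R : realType) (Y X : metricType R) (N : nat)
    (x : 'I_N -> X) (r : R) :
  (forall p, exists i, x i = p) ->
  (forall i j, i != j -> r <= mdist (x i) (x j)) ->
  (gh_dist Y X < r%:E)%E ->
  exists P : 'I_N -> set Y,
    [/\ partition [set: 'I_N] P [set: Y],
        forall i, (diam (P i) <= r%:E)%E &
        forall i j, dist (P i) (P j) = (mdist (x i) (x j))%:E].
Proof.
move=> xsurj rx /ereal_inf_lt[_ [Z [f [g [hZ hf hg ->]]]]].
move=> /ereal_inf_lt[_ [s [s0 fg gf] <-]]; rewrite lte_fin => sr.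
pose P i := [set y | mdist (f y) (g (x i)) < r].
have P0 i : P i !=set0.
  have [_ [y _ <-]] := gf (g (x i)) (imageT _ _).
  rewrite ballEmdist/= => ys; exists y; exact: lt_trans ys sr.
have Pneq i j y z : i != j -> P i y -> P j z ->
    mdist y z = mdist (x i) (x j).
  move=> ij Py Pz; rewrite -hf -hg; apply: ultra_isosceles => //; rewrite hg.
    exact: lt_le_trans Py (rx _ _ ij).
  exact: lt_le_trans Pz (rx _ _ ij).
exists P; split=> [|i|i j].
- split=> //.
    apply/seteqP; split=> // y _.
    have [_ [p _ <-]] := fg (f y) (imageT _ _).
    have [i <-] := xsurj p.
    rewrite ballEmdist/= metric_sym => ys; exists i => //.
    exact: lt_trans ys sr.
  (* A common point of two distinct pieces would put their centres at distance 0, below the gap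
     [r]. *)
  move=> i j _ _ [y [Piy Pjy]]; apply/eqP/negPn/negP => ij.
  have := Pneq _ _ _ _ ij Piy Pjy; rewrite mdistxx => xij.
  have := rx _ _ ij; rewrite -xij leNgt.
  by rewrite (lt_trans s0 sr).
- apply: ge_ereal_sup => _ [y [z [Py Pz ->]]]; rewrite lee_fin -hf ltW//.
  by apply: (ultra_lt hZ Py); rewrite metric_sym.
- have [<-|ij] := eqVneq i j; first by rewrite mdistxx dist_self.
  by apply: dist_const => // y z; exact: Pneq.
Qed.

(** * Gluing two ultrametric spaces along a map *)

Section glue.
Context {R : realType} {Y X : metricType R} {p : Y -> X} {e : R}.
Hypotheses (hX : non_archimedean X) (hY : non_archimedean Y) (e0 : 0 < e).
Hypothesis p_le : forall y z, mdist (p y) (p z) <= mdist y z.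
Hypothesis p_ge : forall y z, mdist y z <= Num.max e (mdist (p y) (p z)).

(* The hypotheses are arguments of the carrier so that the metric structure
   can be attached to it canonically. *)
Definition glue of 0 < e & non_archimedean X & non_archimedean Y &
    (forall y z, mdist (p y) (p z) <= mdist y z) &
    (forall y z, mdist y z <= Num.max e (mdist (p y) (p z))) : Type :=
  (Y + X)%type.

Definition glue_mdist (a b : Y + X) : R :=
  match a, b with
  | inl y, inl z => mdist y z
  | inl y, inr q => Num.max e (mdist (p y) q)
  | inr q, inl y => Num.max e (mdist (p y) q)
  | inr q, inr q' => mdist q q'
  end.

Lemma glue_mdistxx a : glue_mdist a a = 0.
Proof. by case: a => a /=; rewrite mdistxx. Qed.

Lemma glue_mdist_sym a b : glue_mdist a b = glue_mdist b a.
Proof. by case: a => a; case: b => b //=; rewrite metric_sym. Qed.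

Lemma glue_mdist_ge0 a b : 0 <= glue_mdist a b.
Proof. by case: a => a; case: b => b /=; rewrite ?le_max ?mdist_ge0 ?orbT. Qed.

Lemma glue_mdist_positivity a b : glue_mdist a b = 0 -> a = b.
Proof.
(* Points of different summands are at least [e] apart, so they never need to be identified. *)
have max0 t : Num.max e t <> 0.
  by move=> /eqP; rewrite gt_eqF// lt_max e0.
by case: a => a; case: b => b /=; do ?[move=> /mdist_positivity->|move=> /max0].
Qed.

(** Each mixed case reduces to the ultrametric inequality in [X] for the images under [p]: [p_le]
    handles a side within [Y] on the right, [p_ge] one on the left. *)
Lemma glue_mdist_ultra b a c :
  glue_mdist a c <= Num.max (glue_mdist a b) (glue_mdist b c).
Proof.
case: a => a; case: b => b; case: c => c //=.
- rewrite maxA ge_max !le_max lexx/= orbT/=.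
  have := hX (p a) (p b) c; rewrite le_max => /orP[|->]; rewrite ?orbT//.
  by move=> /le_trans->.
- rewrite (le_trans (p_ge _ _))// ge_max !le_max lexx/=.
  by have := hX (p a) b (p c); rewrite le_max (metric_sym b) => /orP[]->;
    rewrite ?orbT.
- rewrite ge_max !le_max lexx/=.
  by have := hX (p a) b c; rewrite le_max => /orP[]->; rewrite ?orbT.
- rewrite ge_max !le_max lexx/=.
  have := hX (p c) (p b) a; rewrite le_max => /orP[|->]; rewrite ?orbT//.
  by move=> /le_trans h; rewrite (h (mdist b c)) ?orbT// metric_sym.
- have := hX a (p b) c; rewrite (metric_sym a (p b)) !le_max => /orP[]->;
  by rewrite ?orbT.
- rewrite ge_max !le_max lexx/= orbT/=.
  have := hX (p c) b a; rewrite (metric_sym b a) !le_max => /orP[]->;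
  by rewrite ?orbT.
Qed.

Lemma glue_mdist_triangle b a c :
  glue_mdist a c <= glue_mdist a b + glue_mdist b c.
Proof.
apply: (le_trans (glue_mdist_ultra b a c)).
by rewrite ge_max lerDl lerDr !glue_mdist_ge0.
Qed.

Local Notation Z := (glue e0 hX hY p_le p_ge).

HB.instance Definition _ := Choice.on Z.
HB.instance Definition _ := @isMetric.Build R Z glue_mdist glue_mdistxx
  glue_mdist_positivity glue_mdist_sym glue_mdist_triangle.

Lemma gh_dist_glue : (forall q, exists y, p y = q) -> (gh_dist Y X <= e%:E)%E.
Proof.
(* Since [y] and [p y] are exactly [e] apart and neighborhoods are open, a slack [t] is required. *)
move=> psurj; apply/lee_addgt0Pr => t t0; rewrite -EFinD.
have et : e < e + t by rewrite ltrDl.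
apply: ge_ereal_inf; exists (hausdorff_dist (range (inl : Y -> Z))
  (range (inr : X -> Z))).
  by exists Z, inl, inr; split=> // a b c; exact: glue_mdist_ultra.
apply: ereal_inf_lbound; exists (e + t) => //; split.
- exact: lt_trans et.
- move=> _ [y _ <-]; exists (inr (p y)) => //.
  by rewrite ballEmdist/= /mdist/= mdistxx max_l// ltW.
- move=> _ [q _ <-]; have [y <-] := psurj q.
  exists (inl y) => //.
  by rewrite ballEmdist/= /mdist/= mdistxx max_l// ltW.
Qed.

End glue.

(** The gluing map sends a point to the centre of its piece. It collapses each piece, whose diameter
    is at most [e], preserves distances across pieces because [e] is below the gap, and is onto
    because pieces are non-empty. *)
Lemma gh_dist_of_partition (R : realType) (Y X : metricType R) (N : nat)
    (x : 'I_N -> X) (P : 'I_N -> set Y) (e : R) :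
  non_archimedean Y -> non_archimedean X -> (forall q, exists i, x i = q) ->
  0 < e -> (forall i j, i != j -> e < mdist (x i) (x j)) ->
  partition [set: 'I_N] P [set: Y] ->
  (forall i, (diam (P i) <= e%:E)%E) ->
  (forall i j, dist (P i) (P j) = (mdist (x i) (x j))%:E) ->
  (gh_dist Y X <= e%:E)%E.
Proof.
move=> hY hX xsurj e0 ex [Pcov Ptriv P0] Pdiam Pdist.
have /choice[k Pk] : forall y, exists i, P i y.
  move=> y; have : [set: Y] y by [].
  by rewrite -Pcov => -[i _ Piy]; exists i.
have kP i y : P i y -> k y = i.
  by move=> Piy; apply: Ptriv => //; exists y.
have kneq y z : k y != k z -> mdist y z = mdist (x (k y)) (x (k z)).
  move=> kyz; exact: (mdist_eq_dist hY (Pdiam _) (Pdiam _) (Pdist _ _)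
    (ex _ _ kyz)).
apply: (@gh_dist_glue _ _ _ (x \o k)) => //= [y z|y z|q].
- have [->|kyz] := eqVneq (k y) (k z); first by rewrite mdistxx mdist_ge0.
  by rewrite kneq.
- rewrite le_max; have [kyz|kyz] := eqVneq (k y) (k z).
    by rewrite (mdist_le_diam (Pdiam (k z)))// -kyz.
  by rewrite kneq// lexx orbT.
- have [i <-] := xsurj q; have [y Piy] := P0 i I.
  by exists y; rewrite (kP _ _ Piy).
Qed.

(** * The gap of a finite space, and the equivalence *)

Lemma finite_separation (R : realType) (X : metricType R) (N : nat)
    (x : 'I_N -> X) : injective x ->
  exists2 d : R, 0 < d & forall i j, i != j -> d < mdist (x i) (x j).
Proof.
move=> xinj.
(* The default 1 keeps [m] positive when there are no distinct pairs; halving [m] makes the bound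
   strict. *)
pose m := \big[Num.min/1]_(ij : 'I_N * 'I_N | ij.1 != ij.2)
  mdist (x ij.1) (x ij.2).
have m0 : 0 < m.
  apply: lt_bigmin => // -[i j] /= ij.
  by rewrite mdist_gt0 (inj_eq xinj).
exists (m / 2) => [|i j ij]; first by rewrite divr_gt0.
apply: (@lt_le_trans _ _ m); last exact: (@bigmin_le_cond _ _ _ _ (i, j)).
by rewrite ltr_pdivrMr// ltr_pMr// ltr1n.
Qed.

Theorem theorem3p9 (R : realType) (X_ : nat -> metricType R)
    (X : metricType R) (N : nat) (x : 'I_N -> X)
    (hX_ : forall n, non_archimedean (X_ n))
    (hX : non_archimedean X)
    (hx : bijective x) :
  gh_converges X_ X <->
  exists P : forall n, 'I_N -> set (X_ n),
    [/\ \forall n \near \oo, partition [set: 'I_N] (P n) [set: X_ n],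
        forall i, diam (P n i) @[n --> \oo] --> 0%E &
        forall i j, \forall n \near \oo,
          dist (P n i) (P n j) = (mdist (x i) (x j))%:E].
Proof.
have xsurj q : exists i, x i = q by case: hx => g _ gK; exists (g q).
have [d d0 dx] := finite_separation (bij_inj hx).
have gh0 : \forall n \near \oo, (0 <= gh_dist (X_ n) X)%E.
  by apply: nearW => n; exact: gh_dist_ge0.
split=> [/(cvge0_nneg gh0) ghX|[P [Ppart Pdiam Pdist]]].
(* A family is chosen for every [n], with empty sets as a default while the distance is still at
   least [d]. *)
- have Pex n : exists Q : 'I_N -> set (X_ n), (gh_dist (X_ n) X < d%:E)%E ->
      [/\ partition [set: 'I_N] Q [set: X_ n],
        forall i, (diam (Q i) <= gh_dist (X_ n) X + n.+1%:R^-1%:E)%E &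
        forall i j, dist (Q i) (Q j) = (mdist (x i) (x j))%:E].
    have [ghd|] := pselect (gh_dist (X_ n) X < d%:E)%E;
      last by exists (fun=> set0).
    have ghfin : gh_dist (X_ n) X \is a fin_num.
      by rewrite ge0_fin_numE ?gh_dist_ge0// (lt_trans ghd)// ltry.
    (* The term [n.+1%:R^-1] makes [r] exceed the distance strictly yet vanish in the limit; the cap
       [d] keeps [r] below the gap. *)
    pose r := Num.min d (fine (gh_dist (X_ n) X) + n.+1%:R^-1).
    have ghr : (gh_dist (X_ n) X < r%:E)%E.
      rewrite -(fineK ghfin) lte_fin lt_min -lte_fin fineK// ghd/=.
      by rewrite ltrDl invr_gt0.
    have rx i j : i != j -> r <= mdist (x i) (x j).
      by move=> ij; rewrite (le_trans _ (ltW (dx _ _ ij)))// ge_min lexx.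
    have [Q [Qpart Qdiam Qdist]] := partition_of_gh_dist xsurj rx ghr.
    exists Q => _; split=> // i; rewrite (le_trans (Qdiam i))//.
    by rewrite -(fineK ghfin) -EFinD lee_fin// ge_min lexx orbT.
  pose P n := projT1 (cid (Pex n)).
  have hP n := projT2 (cid (Pex n)).
  have ghd : \forall n \near \oo, (gh_dist (X_ n) X < d%:E)%E.
    near=> n; apply: (@le_lt_trans _ _ (d / 2)%:E).
      by near: n; apply: ghX; rewrite divr_gt0.
    by rewrite lte_fin ltr_pdivrMr// ltr_pMr// ltr1n.
  exists P; split=> [|i|i j].
  + by apply: filterS ghd => n /hP[].
  + apply/cvge0_nneg => [|e e0].
      by apply: filterS ghd => n /hP[[_ _ P0] _ _]; exact: diam_ge0 (P0 i I).
    near=> n.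
    have /hP[_ /(_ i) Pe _] : (gh_dist (X_ n) X < d%:E)%E by near: n.
    rewrite (le_trans Pe)// (splitr e) EFinD leeD//.
      by near: n; apply: ghX; rewrite divr_gt0.
    rewrite lee_fin ltW//; near: n.
    by apply: near_infty_natSinv_lt (PosNum _); rewrite divr_gt0.
  + by apply: filterS ghd => n /hP[_ _]; exact.
- apply/(cvge0_nneg gh0) => e e0.
  have Pd i c : 0 < c -> \forall n \near \oo, (diam (P n i) <= c%:E)%E.
    apply/cvge0_nneg: c; last exact: Pdiam.
    by apply: filterS Ppart => n [_ _ P0]; exact: diam_ge0 (P0 i I).
  (* Gluing at scale [Num.min e d] stays below the gap and still gives the bound [e]. *)
  have c0 : 0 < Num.min e d by rewrite lt_min e0.
  near=> n; apply: (@le_trans _ _ (Num.min e d)%:E); last first.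
    by rewrite lee_fin ge_min lexx.
  apply: (@gh_dist_of_partition _ _ _ _ x (P n)) => //.
  + by move=> i j /dx; apply: le_lt_trans; rewrite ge_min lexx orbT.
  + by near: n.
  (* Finitely many indices allow one threshold for all pieces. *)
  + by near: n; apply: filter_forall => i; exact: Pd.
  + near: n; apply: filter_forall => i; apply: filter_forall => j.
    exact: Pdist.
Unshelve. all: by end_near. Qed.
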